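(* Let $\mathbb{T}$ be a time scale, let $a,b\in\mathbb{T}$ with $a<b$, and let $f:[a,b]_{\mathbb{T}}\to\mathbb{R}_{\mathcal{F}}$ be a function. Then $f$ is FHK $\Delta$-integrable on $[a,b]_{\mathbb{T}}$ if and only if for each $\epsilon>0$ there exists a $\Delta$-gauge $\delta$ on $[a,b]_{\mathbb{T}}$ such that $$\mathbf{D}\left(S(f,D_{1},\delta),S(f,D_{2},\delta)\right)<\epsilon$$ for any two $\delta$-fine HK divisions $D_{1},D_{2}$ of $[a,b]_{\mathbb{T}}$.
   Context: Fuzzy numbers: $\mathbb{R}_{\mathcal{F}}$ is the set of functions $u:\mathbb{R}\to[0,1]$ that are normal ($u(x_0)=1$ for some $x_0$), fuzzy convex ($u(\lambda x_1+(1-\lambda)x_2)\ge\min\{u(x_1),u(x_2)\}$ for all $x_1,x_2\in\mathbb{R}$, $\lambda\in(0,1)$), upper semicontinuous, and such that $[u]^0:=\overline{\{x:u(x)>0\}}$ is compact. For $\alpha\in(0,1]$, $[u]^\alpha:=\{x:u(x)\ge\alpha\}$; for each $\alpha\in[0,1]$ this is a compact interval, written $[u]^\alpha=[\underline{u^\alpha},\overline{u^\alpha}]$. Addition and real scalar multiplication are defined levelwise: $[u+v]^\alpha=[u]^\alpha+[v]^\alpha$, $[\lambda\odot u]^\alpha=\lambda[u]^\alpha$ for all $\alpha\in[0,1]$. The metric is $\mathbf{D}(u,v)=\sup_{\alpha\in[0,1]}\max\{|\underline{u^\alpha}-\underline{v^\alpha}|,|\overline{u^\alpha}-\overline{v^\alpha}|\}$.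 Time scales: a time scale $\mathbb{T}$ is a nonempty closed subset of $\mathbb{R}$; $[a,b]_{\mathbb{T}}=\{x\in\mathbb{T}:a\le x\le b\}$, and similarly for other intervals. $\sigma(x)=\inf\{y\in\mathbb{T}:y>x\}$ (with $\sigma(\sup\mathbb{T})=\sup\mathbb{T}$ if finite), $\mu(x)=\sigma(x)-x$. A $\Delta$-gauge on $[a,b]_{\mathbb{T}}$ is a pair $\delta=(\delta_L,\delta_R)$ of real functions on $[a,b]_{\mathbb{T}}$ with $\delta_L>0$ on $(a,b]_{\mathbb{T}}$, $\delta_R>0$ on $[a,b)_{\mathbb{T}}$, $\delta_L(a)\ge0$, $\delta_R(b)\ge0$, and $\delta_R(\xi)\ge\mu(\xi)$ for all $\xi\in[a,b)_{\mathbb{T}}$. A $\delta$-fine HK division of $[a,b]_{\mathbb{T}}$ is a finite collection $D=\{([x_{i-1},x_i]_{\mathbb{T}},\xi_i)\}_{i=1}^n$ with $a=x_0<x_1<\dots<x_n=b$ points of $\mathbb{T}$, $\xi_i\in[x_{i-1},x_i]_{\mathbb{T}}$, and $\xi_i-\delta_L(\xi_i)\le x_{i-1}<x_i\le\xi_i+\delta_R(\xi_i)$ for each $i$. Write $\Delta x_i=x_i-x_{i-1}$ and $S(f,D,\delta)=\sum_{i=1}^n f(\xi_i)\Delta x_i$. FHK $\Delta$-integrability: $f:[a,b]_{\mathbb{T}}\to\mathbb{R}_{\mathcal{F}}$ is FHK $\Delta$-integrable on $[a,b]_{\mathbb{T}}$ with integral $\tilde A=(FHK)\int_{[a,b]_{\mathbb{T}}}f(x)\Delta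 x\in\mathbb{R}_{\mathcal{F}}$ if for each $\epsilon>0$ there is a $\Delta$-gauge $\delta$ on $[a,b]_{\mathbb{T}}$ with $\mathbf{D}(S(f,D,\delta),\tilde A)<\epsilon$ for every $\delta$-fine HK division $D$ of $[a,b]_{\mathbb{T}}$. *)

(* Defs.v *)
From HB Require Import structures.
From mathcomp Require Import all_boot all_order all_algebra.
From mathcomp Require Import all_classical all_reals all_analysis.
From mathcomp Require Import ring lra.

Set Implicit Arguments.
Unset Strict Implicit.
Unset Printing Implicit Defensive.

Import Order.TTheory GRing.Theory Num.Theory.
Import numFieldNormedType.Exports.

Local Open Scope classical_set_scope.
Local Open Scope ring_scope.

Definition upper_semicontinuous (R : realType) (u : R -> R) : Prop :=
  forall x a, u x < a -> \forall y \near x, u y < a.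

Record fuzzy (R : realType) : Type := Fuzzy {
  fuzzy_fun :> R -> R ;
  fuzzy_ge0 : forall x, 0 <= fuzzy_fun x ;
  fuzzy_le1 : forall x, fuzzy_fun x <= 1 ;
  fuzzy_normal : exists x0, fuzzy_fun x0 = 1 ;
  fuzzy_convex : forall x1 x2 t, 0 < t < 1 ->
    Num.min (fuzzy_fun x1) (fuzzy_fun x2) <= fuzzy_fun (t * x1 + (1 - t) * x2) ;
  fuzzy_usc : upper_semicontinuous fuzzy_fun ;
  fuzzy_compact : compact (closure [set x | 0 < fuzzy_fun x]) }.

(* Only meaningful for [al] in [0, 1]. *)
Definition level (R : realType) (u : fuzzy R) (al : R) : set R :=
  if al == 0 then closure [set x | 0 < u x] else [set x | al <= u x].

Definition level_lo (R : realType) (u : fuzzy R) (al : R) : R :=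
  inf (level u al).

Definition level_hi (R : realType) (u : fuzzy R) (al : R) : R :=
  sup (level u al).

Section LevelTheory.
Variable R : realType.
Implicit Types (u v w : fuzzy R) (al be : R).

Lemma level0 u : level u 0 = closure [set x | 0 < u x].
Proof. by rewrite /level eqxx. Qed.

Lemma levelE u al : 0 < al -> level u al = [set x | al <= u x].
Proof. by move=> al0; rewrite /level gt_eqF. Qed.

Lemma level_anti u al be : 0 <= al -> al <= be -> level u be `<=` level u al.
Proof.
rewrite le_eqVlt => /predU1P[<-|al0] ab.
  move: ab; rewrite le_eqVlt => /predU1P[<-//|b0].
  rewrite level0 levelE // => x /= bx; apply: subset_closure => /=.
  exact: lt_le_trans bx.
by rewrite !levelE // ?(lt_le_trans al0)// => x /=; exact: le_trans.
Qed.

Lemma level_nonempty u al : 0 <= al <= 1 -> level u al !=set0.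
Proof.
case/andP=> al0 al1; have [x0 ux0] := fuzzy_normal u; exists x0.
by apply: (level_anti al0 al1); rewrite levelE //= ux0.
Qed.

Lemma level_closed u al : 0 <= al -> closed (level u al).
Proof.
rewrite le_eqVlt => /predU1P[<-|al0].
  by rewrite level0; exact: closed_closure.
rewrite levelE //.
have -> : [set x | al <= u x] = ~` [set x | u x < al].
  by apply/seteqP; split => x /=; [move=> h; apply/negP; rewrite -leNgt
    | move/negP; rewrite -leNgt].
apply: open_closedC; rewrite openE => x /= uxa.
exact: (@fuzzy_usc _ u).
Qed.

Lemma level_compact u al : 0 <= al -> compact (level u al).
Proof.
move=> al0; apply: (@subclosed_compact _ _ (level u 0)).
- exact: level_closed.
- by rewrite level0; exact: fuzzy_compact.
- exact: level_anti.
Qed.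

Lemma fuzzy_min_le u x y z : x <= z -> z <= y -> Num.min (u x) (u y) <= u z.
Proof.
rewrite le_eqVlt => /predU1P[->|xz]; first by rewrite ge_min lexx.
rewrite le_eqVlt => /predU1P[->|zy]; first by rewrite ge_min lexx orbT.
have yx : 0 < y - x by rewrite subr_gt0 (lt_trans xz).
have -> : z = ((y - z) / (y - x)) * x + (1 - (y - z) / (y - x)) * y.
  by field; rewrite gt_eqF.
apply: fuzzy_convex.
have yz : 0 < y - z by rewrite subr_gt0.
by rewrite divr_gt0 //= ltr_pdivrMr // mul1r; lra.
Qed.

Lemma level_convex u al x y z : 0 <= al -> level u al x -> level u al y ->
  x <= z -> z <= y -> level u al z.
Proof.
rewrite le_eqVlt => /predU1P[<-|al0]; last first.
  rewrite !levelE //= => ax ay xz zy; apply: le_trans (fuzzy_min_le u xz zy).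
  by rewrite le_min ax.
rewrite level0 => cx cy; rewrite le_eqVlt => /predU1P[<-//|xz].
rewrite le_eqVlt => /predU1P[->//|zy]; apply: subset_closure => /=.
have [x' [/= ux' x'z]] := cx _ (lt_nbhsl xz).
have [y' [/= uy' zy']] := cy _ (lt_nbhsr zy).
apply: lt_le_trans (fuzzy_min_le u (ltW x'z) (ltW zy')).
by rewrite lt_min ux'.
Qed.


Lemma level_has_sup u al : 0 <= al <= 1 -> has_sup (level u al).
Proof.
move=> h; have /andP[al0 _] := h.
by apply: compact_has_sup; [exact: level_nonempty | exact: level_compact].
Qed.

Lemma level_has_inf u al : 0 <= al <= 1 -> has_inf (level u al).
Proof.
move=> h; have /andP[al0 _] := h; split; first exact: level_nonempty.
have [M [_ MA]] := compact_bounded (level_compact (u := u) al0).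
have M1 : M < M + 1 by rewrite ltrDl.
by exists (- (M + 1)) => y /(MA _ M1) /=; rewrite ler_norml => /andP[].
Qed.

Lemma level_lo_in u al : 0 <= al <= 1 -> level u al (level_lo u al).
Proof.
move=> h; have /andP[al0 _] := h; have [A0 Alb] := level_has_inf u h.
have := level_closed (u := u) al0; rewrite closure_id => ->.
move=> B /nbhs_ballP[e /= e0 eB].
have [x Ax xe] := inf_adherent e0 (level_has_inf u h).
exists x; split=> //; apply: eB; rewrite -ball_normE /= distrC ger0_norm.
  by rewrite ltrBlDl.
by rewrite subr_ge0; exact: ge_inf.
Qed.

Lemma level_hi_in u al : 0 <= al <= 1 -> level u al (level_hi u al).
Proof.
move=> h; have /andP[al0 _] := h; have [A0 Aub] := level_has_sup u h.
have := level_closed (u := u) al0; rewrite closure_id => ->.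
exact: closure_sup.
Qed.

Lemma level_itv u al : 0 <= al <= 1 ->
  level u al = `[level_lo u al, level_hi u al]%classic.
Proof.
move=> h; have /andP[al0 _] := h; apply/seteqP; split=> x /=.
  move=> ux; rewrite in_itv /=; apply/andP; split.
    by apply: ge_inf => //; have [] := level_has_inf u h.
  by apply: ub_le_sup => //; have [] := level_has_sup u h.
rewrite in_itv /= => /andP[]; apply: level_convex => //.
  exact: level_lo_in.
exact: level_hi_in.
Qed.

Lemma level_lo_le_hi u al : 0 <= al <= 1 -> level_lo u al <= level_hi u al.
Proof.
by move=> h; have := level_lo_in u h; rewrite level_itv //= in_itv => /andP[].
Qed.

Lemma fuzzy_ext u v : (forall al, 0 <= al <= 1 -> level u al = level v al) ->
  u = v.
Proof.
move=> uv.
have le_uv (w1 w2 : fuzzy R) :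
    (forall al, 0 <= al <= 1 -> level w1 al = level w2 al) ->
    forall x, w1 x <= w2 x.
  move=> h x; have := fuzzy_ge0 w1 x.
  rewrite le_eqVlt => /predU1P[<-|w0]; first exact: fuzzy_ge0.
  have := h (w1 x); rewrite ltW // fuzzy_le1 => /(_ isT).
  by rewrite !levelE // => /seteqP[/(_ x) + _]; apply => /=.
have E : u =1 v.
  by move=> x; apply/eqP; rewrite eq_le !le_uv // => al h; rewrite uv.
move: u v {uv le_uv} E => [u a b c d e f] [v a' b' c' d' e' f'] /= /funext E.
by case: v / E in a' b' c' d' e' f' *; congr Fuzzy; exact: Prop_irrelevance.
Qed.

(* Goetschel-Voxman conditions: al |-> [l al, r al] is the level family of a
   fuzzy number iff l and - r are nondecreasing, left-continuous on (0, 1] and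
   right-continuous at 0, and l 1 <= r 1. *)
Definition endpoint (l : R -> R) : Prop :=
  [/\ forall al be, 0 <= al -> al <= be -> be <= 1 -> l al <= l be,
      forall al m, 0 < al <= 1 ->
        (forall be, 0 < be < al -> l be <= m) -> l al <= m &
      forall m, (forall be, 0 < be <= 1 -> m <= l be) -> m <= l 0].

Lemma endpoint_lo u : endpoint (level_lo u).
Proof.
split.
- move=> al be al0 ab b1.
  have ha : 0 <= al <= 1 by rewrite al0 (le_trans ab).
  have hb : 0 <= be <= 1 by rewrite (le_trans al0).
  apply: ge_inf; first by have [] := level_has_inf u ha.
  by apply: (level_anti al0 ab); exact: level_lo_in.
- move=> al m /andP[al0 al1] hm; rewrite leNgt; apply/negP => ml.
  have ha : 0 <= al <= 1 by rewrite ltW.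
  suff um : level u al m.
    by move: um; rewrite level_itv //= in_itv /= => /andP[+ _]; rewrite leNgt ml.
  rewrite levelE //= leNgt; apply/negP => uma.
  pose be := (Num.max 0 (u m) + al) / 2.
  have /andP[ub ba] : Num.max 0 (u m) < be < al.
    have mal : Num.max 0 (u m) < al by rewrite gt_max al0.
    by rewrite /be !midf_lt.
  move: ub; rewrite gt_max => /andP[b0 ub].
  have hb : 0 <= be <= 1 by rewrite ltW // (le_trans (ltW ba)).
  suff : level u be m by rewrite levelE //= leNgt ub.
  rewrite level_itv //= in_itv /= hm ?b0 //=.
  apply: le_trans (ltW ml) _.
  have := level_lo_in u ha => /(level_anti (ltW b0) (ltW ba)).
  by rewrite level_itv //= in_itv /= => /andP[].
- move=> m hm; have h0 : 0 <= (0 : R) <= 1 by rewrite lexx ler01.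
  have := level_lo_in u h0; rewrite {1}level0 => c0.
  suff : closed [set x : R | m <= x].
    rewrite closure_id => E; change ([set x : R | m <= x] (level_lo u 0)).
    rewrite E; apply: closure_subset c0 => x /= ux.
    have hx : 0 < u x <= 1 by rewrite ux fuzzy_le1.
    have hx' : 0 <= u x <= 1 by rewrite ltW // fuzzy_le1.
    apply: le_trans (hm _ hx) _; apply: ge_inf.
      by have [] := level_has_inf u hx'.
    by rewrite levelE /=.
  exact: closed_ge.
Qed.

Lemma endpoint_hi u : endpoint (fun al => - level_hi u al).
Proof.
split.
- move=> al be al0 ab b1; rewrite lerN2.
  have ha : 0 <= al <= 1 by rewrite al0 (le_trans ab).
  have hb : 0 <= be <= 1 by rewrite (le_trans al0).
  apply: ub_le_sup; first by have [] := level_has_sup u ha.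
  by apply: (level_anti al0 ab); exact: level_hi_in.
- move=> al m /andP[al0 al1] hm; rewrite leNgt; apply/negP => ml.
  have ha : 0 <= al <= 1 by rewrite ltW.
  suff um : level u al (- m).
    move: um; rewrite level_itv //= in_itv /= => /andP[_].
    by rewrite lerNl leNgt ml.
  rewrite levelE //= leNgt; apply/negP => uma.
  pose be := (Num.max 0 (u (- m)) + al) / 2.
  have /andP[ub ba] : Num.max 0 (u (- m)) < be < al.
    have mal : Num.max 0 (u (- m)) < al by rewrite gt_max al0.
    by rewrite /be !midf_lt.
  move: ub; rewrite gt_max => /andP[b0 ub].
  have hb : 0 <= be <= 1 by rewrite ltW // (le_trans (ltW ba)).
  suff : level u be (- m) by rewrite levelE //= leNgt ub.
  rewrite level_itv //= in_itv /=; apply/andP; split; last first.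
    by rewrite lerNl; apply: hm; rewrite b0.
  apply: le_trans (_ : level_hi u al <= - m); last by rewrite lerNr ltW.
  have := level_hi_in u ha => /(level_anti (ltW b0) (ltW ba)).
  by rewrite level_itv //= in_itv /= => /andP[].
- move=> m hm; have h0 : 0 <= (0 : R) <= 1 by rewrite lexx ler01.
  have := level_hi_in u h0; rewrite {1}level0 lerNr => c0.
  suff : closed [set x : R | x <= - m].
    rewrite closure_id => E; change ([set x : R | x <= - m] (level_hi u 0)).
    rewrite E; apply: closure_subset c0 => x /= ux.
    have hx : 0 < u x <= 1 by rewrite ux fuzzy_le1.
    have hx' : 0 <= u x <= 1 by rewrite ltW // fuzzy_le1.
    apply: le_trans (_ : level_hi u (u x) <= - m); last by rewrite lerNr hm.
    apply: ub_le_sup; first by have [] := level_has_sup u hx'.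
    by rewrite levelE /=.
  exact: closed_le.
Qed.

Section OfEndpoints.
Variables l r : R -> R.
Hypotheses (el : endpoint l) (er : endpoint (fun al => - r al)) (lr1 : l 1 <= r 1).

Let S x : set R := [set 0] `|` [set al | 0 < al <= 1 /\ l al <= x <= r al].
Let w x : R := sup (S x).

Let ubS x : ubound (S x) 1.
Proof. by move=> al [->|[/andP[]//]]. Qed.

Let S0 x : S x 0. Proof. by left. Qed.

Let w_ge x al : S x al -> al <= w x.
Proof. by move=> h; apply: ub_le_sup => //; exists 1. Qed.

Let r_anti al be : 0 <= al -> al <= be -> be <= 1 -> r be <= r al.
Proof. by case: er => h _ _ *; rewrite -lerN2; exact: h. Qed.

Let l_mono al be : 0 <= al -> al <= be -> be <= 1 -> l al <= l be.
Proof. by case: el => h _ _; exact: h. Qed.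

Let lr al : 0 <= al <= 1 -> l al <= r al.
Proof.
move=> /andP[a0 a1]; apply: le_trans (l_mono a0 a1 _) _ => //.
by apply: le_trans lr1 _; exact: r_anti.
Qed.

Let w_level al x : 0 < al <= 1 -> (al <= w x) = (l al <= x <= r al).
Proof.
move=> h; have /andP[a0 a1] := h; apply/idP/idP => [aw|]; last first.
  by move=> hx; apply: w_ge; right.
have H be : 0 < be < al -> l be <= x <= r be.
  case/andP=> b0 ba.
  have wb : 0 < w x - be by rewrite subr_gt0 (lt_le_trans ba).
  have hs : has_sup (S x) by split; [exists 0 | exists 1].
  have [ga [->|[/andP[g0 g1] /andP[lx xr]]]] := sup_adherent wb hs.
    by rewrite -/(w x) subKr ltNge ltW.
  rewrite -/(w x) subKr => bg; apply/andP; split.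
    by apply: le_trans lx; apply: l_mono => //; exact: ltW.
  by apply: (le_trans xr); apply: r_anti => //; exact: ltW.
apply/andP; split.
  by case: el => _ h' _; apply: h' => // be /H /andP[].
rewrite -lerN2; case: er => _ h' _; apply: h' => // be /H /andP[_].
by rewrite lerN2.
Qed.

Let w_ge0 x : 0 <= w x. Proof. exact: w_ge. Qed.

Let w_le1 x : w x <= 1.
Proof. by apply: ge_sup; [exists 0 | exact: ubS]. Qed.

Let w_pos x : (0 < w x) -> l (w x) <= x <= r (w x).
Proof. by move=> w0; rewrite -w_level ?lexx // w0 w_le1. Qed.

Let w_normal : exists x0, w x0 = 1.
Proof.
exists (l 1); apply/eqP; rewrite eq_le w_le1 w_level ?ltr01 ?lexx //=.
Qed.

Let w_convex x1 x2 t : 0 < t < 1 ->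
  Num.min (w x1) (w x2) <= w (t * x1 + (1 - t) * x2).
Proof.
move=> /andP[t0 t1]; set m := Num.min _ _.
have [m0|m0] := leP m 0; first exact: le_trans m0 (w_ge0 _).
have m1 : 0 < m <= 1 by rewrite m0 ge_min w_le1.
have : m <= w x1 by rewrite ge_min lexx.
have : m <= w x2 by rewrite ge_min lexx orbT.
rewrite !w_level // => /andP[l2 r2] /andP[l1 r1]; apply/andP; split; nra.
Qed.

Let w_usc : upper_semicontinuous w.
Proof.
move=> x a wa.
have [a1|a1] := ltP 1 a.
  by near=> y; exact: le_lt_trans (w_le1 _) a1.
have a0 : 0 < a by exact: le_lt_trans (w_ge0 _) wa.
have ha : 0 < a <= 1 by rewrite a0.
have : ~~ (a <= w x) by rewrite -ltNge.
rewrite w_level // negb_and -!ltNge => /orP[xl|rx].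
  have := lt_nbhsl xl; apply: filterS => y yl.
  by rewrite ltNge w_level // negb_and -!ltNge yl.
have := lt_nbhsr rx; apply: filterS => y yl.
by rewrite ltNge w_level // negb_and -!ltNge yl orbT.
Unshelve. all: by end_near. Qed.

Let w_closure : closure [set x | 0 < w x] = `[l 0, r 0]%classic.
Proof.
have h0 : 0 <= (0 : R) <= 1 by rewrite lexx ler01.
have lr0 := lr h0.
apply/seteqP; split.
  rewrite [X in _ `<=` X](_ : _ = closure `[l 0, r 0]%classic).
    apply: closure_subset => x /= wx; rewrite in_itv /=.
    have /andP[lx xr] := w_pos wx; apply/andP; split.
      by apply: le_trans lx; apply: l_mono => //; exact: ltW.
    by apply: (le_trans xr); apply: r_anti => //; exact: ltW.
  by rewrite -closure_id; exact: itv_closed.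
move=> x /=; rewrite in_itv /= => /andP[lx xr] B /nbhs_ballP[e /= e0 eB].
have [be hb lb] : exists2 be, 0 < be <= 1 & l be < x + e.
  apply: contrapT => no; suff : x + e <= l 0 by lra.
  case: el => _ _; apply => be hb; rewrite leNgt; apply/negP => h.
  by apply: no; exists be.
have [ga hg rg] : exists2 be, 0 < be <= 1 & x - e < r be.
  apply: contrapT => no; suff : e - x <= - r 0 by lra.
  case: er => _ _; apply => ga hg; rewrite lerNr opprB leNgt; apply/negP => h.
  by apply: no; exists ga.
pose k := Num.min be ga.
have /andP[b0 b1] := hb; have /andP[g0 g1] := hg.
have hk : 0 < k <= 1 by rewrite lt_min b0 g0 ge_min b1.
have /andP[k0 k1] := hk.
have lk : l k < x + e.
  by apply: le_lt_trans lb; apply: l_mono; rewrite ?ge_min ?lexx // ltW.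
have rk : x - e < r k.
  by apply: lt_le_trans rg _; apply: r_anti; rewrite ?ge_min ?lexx ?orbT // ltW.
have lrk : l k <= r k by apply: lr; rewrite ltW.
have W y : l k <= y <= r k -> 0 < w y.
  by move=> h; apply: (lt_le_trans k0); rewrite w_level.
pose y := Num.max (l k) (Num.min x (r k)).
exists y; rewrite /y; split.
  by apply: W; rewrite le_max lexx /= ge_max lrk ge_min lexx orbT.
apply: eB; rewrite -ball_normE /= ltr_norml.
case: (leP x (r k)) => h1.
  by case: (leP (l k) x) => h2; apply/andP; split; lra.
by case: (leP (l k) (r k)) => h2; apply/andP; split; lra.
Qed.

Lemma fuzzy_of_endpoints :
  exists u, forall al, 0 <= al <= 1 -> level u al = `[l al, r al]%classic.
Proof.
have w_compact : compact (closure [set x | 0 < w x]).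
  by rewrite w_closure; exact: segment_compact.
exists (Fuzzy w_ge0 w_le1 w_normal w_convex w_usc w_compact) => al.
case/andP; rewrite le_eqVlt => /predU1P[<- _|a0 a1]; first by rewrite level0.
rewrite levelE //=; apply/seteqP.
by split=> x /=; rewrite in_itv /= w_level // a0.
Qed.

End OfEndpoints.

Lemma endpointD l1 l2 : endpoint l1 -> endpoint l2 ->
  endpoint (fun al => l1 al + l2 al).
Proof.
move=> [m1 c1 z1] [m2 c2 z2]; split.
- by move=> *; rewrite lerD ?m1 ?m2.
- move=> al m h hm; rewrite -lerBrDr; apply: c1 => // be /andP[b0 ba].
  rewrite lerBrDr -lerBrDl; apply: c2 => // ga /andP[g0 ga'].
  rewrite lerBrDl; pose k := Num.max be ga; have /andP[a0 a1] := h.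
  have kal : k < al by rewrite gt_max ba.
  apply: le_trans (hm k _); last by rewrite lt_max b0.
  have k1 : k <= 1 by apply: le_trans (ltW kal) a1.
  by apply: lerD; [apply: m1|apply: m2]; rewrite ?le_max ?lexx ?orbT // ltW.
- move=> m hm; rewrite -lerBlDr; apply: z1 => be /andP[b0 b1].
  rewrite lerBlDr -lerBlDl; apply: z2 => ga /andP[g0 g1].
  rewrite lerBlDl; pose k := Num.min be ga.
  have k0 : 0 < k by rewrite lt_min b0.
  apply: le_trans (hm k _) _; first by rewrite k0 ge_min b1.
  by apply: lerD; [apply: m1|apply: m2]; rewrite ?ge_min ?lexx ?orbT // ltW.
Qed.

Lemma endpointZ c l : 0 < c -> endpoint l -> endpoint (fun al => c * l al).
Proof.
move=> c0 [m1 c1 z1]; split.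
- by move=> *; rewrite ler_pM2l ?m1.
- move=> al m h hm; rewrite mulrC -ler_pdivlMr //; apply: c1 => // be hb.
  by rewrite ler_pdivlMr // mulrC hm.
- move=> m hm; rewrite mulrC -ler_pdivrMr //; apply: z1 => be hb.
  by rewrite ler_pdivrMr // mulrC hm.
Qed.

Lemma endpoint_cst c : endpoint (fun=> c).
Proof.
split=> //.
  move=> al m /andP[a0 a1] h; apply: (h (al / 2)); lra.
by move=> m h; apply: (h 1); rewrite ltr01 lexx.
Qed.

Lemma eq_endpoint l1 l2 : l1 =1 l2 -> endpoint l1 -> endpoint l2.
Proof. by move=> /funext ->. Qed.

Lemma addf_exists u v : exists w, forall al, 0 <= al <= 1 ->
  level w al = [set x + y | x in level u al & y in level v al].
Proof.
have er : endpoint (fun al => - (level_hi u al + level_hi v al)).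
  apply: eq_endpoint (endpointD (endpoint_hi u) (endpoint_hi v)) => al /=.
  by rewrite opprD.
have h1 : 0 <= (1 : R) <= 1 by rewrite lexx ler01.
have [|w hw] := fuzzy_of_endpoints
  (endpointD (endpoint_lo u) (endpoint_lo v)) er.
  by rewrite lerD ?level_lo_le_hi.
exists w => al h; rewrite hw // !level_itv //.
have lu := level_lo_le_hi u h; have lv := level_lo_le_hi v h.
apply/seteqP; split=> z /=; rewrite ?in_itv /=; last first.
  by case=> x + [y + <-]; rewrite !in_itv /= => /andP[? ?] /andP[? ?];
    rewrite !lerD.
case/andP=> lz zr.
exists (Num.max (level_lo u al) (z - level_hi v al)).
  by rewrite in_itv /= le_max lexx /= ge_max lu lerBlDr.
exists (z - Num.max (level_lo u al) (z - level_hi v al)); last by rewrite addrC subrK.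
by rewrite in_itv /=; case: (leP (level_lo u al) (z - level_hi v al)) => ?;
  apply/andP; split; lra.
Qed.

Lemma scalef_exists c u : exists w, forall al, 0 <= al <= 1 ->
  level w al = [set c * x | x in level u al].
Proof.
have h1 : 0 <= (1 : R) <= 1 by rewrite lexx ler01.
have [c0|c0|->] := ltgtP c 0.
- have c0' : 0 < - c by rewrite oppr_gt0.
  have el : endpoint (fun al => c * level_hi u al).
    apply: eq_endpoint (endpointZ c0' (endpoint_hi u)) => al /=.
    by rewrite mulrNN.
  have er : endpoint (fun al => - (c * level_lo u al)).
    apply: eq_endpoint (endpointZ c0' (endpoint_lo u)) => al /=.
    by rewrite mulNr.
  have [|w hw] := fuzzy_of_endpoints el er.
    by rewrite ler_nM2l // level_lo_le_hi.
  exists w => al h; rewrite hw // level_itv //.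
  apply/seteqP; split=> z /=; rewrite in_itv /=.
    case/andP=> a b; exists (c^-1 * z); last by rewrite mulVKf // lt_eqF.
    by rewrite in_itv /= mulrC ler_ndivlMr // ler_ndivrMr // mulrC b mulrC a.
  by case=> x; rewrite in_itv /= => /andP[a b] <-; rewrite !ler_nM2l // b.
- have er : endpoint (fun al => - (c * level_hi u al)).
    apply: eq_endpoint (endpointZ c0 (endpoint_hi u)) => al /=.
    by rewrite mulrN.
  have [|w hw] := fuzzy_of_endpoints (endpointZ c0 (endpoint_lo u)) er.
    by rewrite ler_pM2l // level_lo_le_hi.
  exists w => al h; rewrite hw // level_itv //.
  apply/seteqP; split=> z /=; rewrite in_itv /=.
    case/andP=> a b; exists (c^-1 * z); last by rewrite mulVKf // gt_eqF.
    by rewrite in_itv /= mulrC ler_pdivlMr // ler_pdivrMr // mulrC a mulrC b.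
  by case=> x; rewrite in_itv /= => /andP[a b] <-; rewrite !ler_pM2l // a.
- have [|w hw] := fuzzy_of_endpoints (endpoint_cst 0) (endpoint_cst (- 0)).
    by rewrite lexx.
  exists w => al h; rewrite hw //; apply/seteqP; split=> z /=.
    rewrite in_itv /= -eq_le => /eqP <-; have [x ux] := level_nonempty u h.
    by exists x; rewrite ?mul0r.
  by case=> x _ <-; rewrite mul0r in_itv /= lexx.
Qed.

Lemma crispf_exists c : exists w, forall al, 0 <= al <= 1 ->
  level w al = [set c].
Proof.
have [|w hw] := fuzzy_of_endpoints (endpoint_cst c) (endpoint_cst (- c)).
  by rewrite lexx.
exists w => al h; rewrite hw //; apply/seteqP; split=> z /=.
  by rewrite in_itv /= -eq_le => /eqP.
by move=> ->; rewrite in_itv /= lexx.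
Qed.

Definition addf u v : fuzzy R := sval (cid (addf_exists u v)).

Definition scalef (c : R) u : fuzzy R := sval (cid (scalef_exists c u)).

Definition zerof : fuzzy R := sval (cid (crispf_exists 0)).

Lemma level_addf u v al : 0 <= al <= 1 ->
  level (addf u v) al = [set x + y | x in level u al & y in level v al].
Proof. by rewrite /addf; case: cid => w /= h; exact: h. Qed.

Lemma level_scalef c u al : 0 <= al <= 1 ->
  level (scalef c u) al = [set c * x | x in level u al].
Proof. by rewrite /scalef; case: cid => w /= h; exact: h. Qed.

Lemma level_zerof al : 0 <= al <= 1 -> level zerof al = [set 0].
Proof. by rewrite /zerof; case: cid => w /= h; exact: h. Qed.

Lemma addfA : associative addf.
Proof.
move=> u v w; apply: fuzzy_ext => al h; rewrite !level_addf //.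
apply/seteqP; split=> z /=.
  case=> x ux [_ [y vy [t wt <-]] <-].
  by exists (x + y); [exists x => //; exists y | exists t; rewrite ?addrA].
case=> _ [x ux [y vy <-]] [t wt <-].
by exists x => //; exists (y + t); rewrite ?addrA //; exists y => //; exists t.
Qed.

Lemma addfC : commutative addf.
Proof.
move=> u v; apply: fuzzy_ext => al h; rewrite !level_addf //.
by apply/seteqP; split=> z /= [x ux [y vy <-]]; exists y => //;
  exists x => //; rewrite addrC.
Qed.

Lemma add0f : left_id zerof addf.
Proof.
move=> u; apply: fuzzy_ext => al h; rewrite level_addf // level_zerof //.
apply/seteqP; split=> z /=; first by case=> _ -> [y uy <-]; rewrite add0r.
by move=> uz; exists 0 => //; exists z; rewrite ?add0r.
Qed.

HB.instance Definition _ := Monoid.isComLaw.Build (fuzzy R) zerof addf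
  addfA addfC add0f.

Definition fdist u v : R :=
  sup [set Num.max `|level_lo u al - level_lo v al|
                   `|level_hi u al - level_hi v al| | al in `[0, 1]%classic].

Lemma fdist_has_sup u v :
  has_sup [set Num.max `|level_lo u al - level_lo v al|
                       `|level_hi u al - level_hi v al| | al in `[0, 1]%classic].
Proof.
split; first by exists (Num.max `|level_lo u 0 - level_lo v 0|
    `|level_hi u 0 - level_hi v 0|), 0 => //=; rewrite in_itv /= lexx ler01.
have [ml _ _] := endpoint_lo u; have [ml' _ _] := endpoint_lo v.
have [mr _ _] := endpoint_hi u; have [mr' _ _] := endpoint_hi v.
exists (`|level_lo u 0| + `|level_hi u 0| + `|level_lo v 0| + `|level_hi v 0|).
move=> _ [al /= + <-]; rewrite in_itv /= => h; have /andP[a0 a1] := h.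
have lu := level_lo_le_hi u h; have lv := level_lo_le_hi v h.
have := ml _ _ (lexx _) a0 a1; have := ml' _ _ (lexx _) a0 a1.
have := mr _ _ (lexx _) a0 a1; have := mr' _ _ (lexx _) a0 a1.
have N (x : R) : - `|x| <= x <= `|x| by rewrite -ler_norml.
have /andP[] := N (level_lo u 0); have /andP[] := N (level_lo v 0).
have /andP[] := N (level_hi u 0); have /andP[] := N (level_hi v 0).
move=> *; by rewrite ge_max !ler_norml; apply/andP; split; apply/andP; split; lra.
Qed.

End LevelTheory.

Section TimeScale.
Variable R : realType.
Implicit Types (T : set R) (a b x : R).

Definition time_scale T : Prop := T !=set0 /\ closed T.

Definition ts_itv T (i : interval R) : set R := T `&` [set` i].

(* For [x] in [T], no point of [T] lies above [x] exactly when [x] is the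
   maximum of [T]. *)
Definition sigma T x : R :=
  if `[< exists2 y, T y & x < y >] then inf [set y | T y /\ x < y] else x.

Definition mu T x : R := sigma T x - x.

(* The pair (delta_L, delta_R); the values outside of [a, b]_T are never
   used. *)
Definition is_gauge T a b (delta : (R -> R) * (R -> R)) : Prop :=
  [/\ forall x, ts_itv T `]a, b] x -> 0 < delta.1 x,
      forall x, ts_itv T `[a, b[ x -> 0 < delta.2 x,
      0 <= delta.1 a,
      0 <= delta.2 b &
      forall x, ts_itv T `[a, b[ x -> mu T x <= delta.2 x].

(* [div_pt D i] is x_i for i = 0, ..., n, and [div_tag D i] is the tag of the
   interval [x_i, x_(i+1)] for i = 0, ..., n - 1, where n = [div_size D]; the
   other values of the two sequences are irrelevant. *)
Record division : Type := Division {
  div_size : nat ;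
  div_pt : nat -> R ;
  div_tag : nat -> R }.

Definition is_fine T a b (delta : (R -> R) * (R -> R)) (D : division) : Prop :=
  let n := div_size D in let x := div_pt D in let xi := div_tag D in
  [/\ x 0 = a,
      x n = b,
      forall i, (i <= n)%N -> T (x i) &
      forall i, (i < n)%N ->
        [/\ ts_itv T `[x i, x i.+1] (xi i),
            xi i - delta.1 (xi i) <= x i,
            x i < x i.+1 &
            x i.+1 <= xi i + delta.2 (xi i)]].

(* A function on [a, b]_T is encoded by a total [f], evaluated only at the
   tags, which lie in [a, b]_T when [D] is fine. *)
Definition riemann_sum (f : R -> fuzzy R) (D : division) : fuzzy R :=
  \big[@addf R / @zerof R]_(i < div_size D)
    scalef (div_pt D i.+1 - div_pt D i) (f (div_tag D i)).

Definition is_fhk_integral T a b (f : R -> fuzzy R) (A : fuzzy R) : Prop :=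
  forall e, 0 < e -> exists delta, is_gauge T a b delta /\
    forall D, is_fine T a b delta D -> fdist (riemann_sum f D) A < e.

Definition fhk_integrable T a b (f : R -> fuzzy R) : Prop :=
  exists A, is_fhk_integral T a b f A.

End TimeScale.

(* Main.v *)
(** Cauchy's criterion is completeness of the metric [D] on fuzzy numbers,
    applied to the filter generated by the sets of Riemann sums over
    delta-fine divisions, delta ranging over the gauges. This is a filter base
    because the pointwise minimum of two gauges is again a gauge. Completeness
    holds because the endpoint functions converge uniformly in the level, and
    uniform limits preserve the Goetschel-Voxman conditions. *)
Require Import Defs.
From mathcomp Require Import all_boot all_order all_algebra.
From mathcomp Require Import all_classical all_reals all_analysis.
From mathcomp Require Import lra.
Import Order.TTheory GRing.Theory Num.Theory.
Import numFieldNormedType.Exports.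
Local Open Scope ring_scope.
Set Implicit Arguments.
Unset Strict Implicit.
Unset Printing Implicit Defensive.

Section FuzzyMetric.
Context {R : realType}.
Implicit Types (u v w : fuzzy R) (al e : R) (l : R -> R).
Local Open Scope classical_set_scope.

(** The inequality is non-strict because only such bounds on all levels pass to the supremum
    defining [fdist]. This turns later work on the metric into estimates on endpoints. *)
Lemma fdist_leP u v e :
  fdist u v <= e <-> forall al, 0 <= al <= 1 ->
    `|level_lo u al - level_lo v al| <= e /\
    `|level_hi u al - level_hi v al| <= e.
Proof.
have [ne ub] := fdist_has_sup u v; split=> [uve al al01|uve].
  suff : Num.max `|level_lo u al - level_lo v al|
                 `|level_hi u al - level_hi v al| <= e.
    by rewrite ge_max => /andP.
  by apply: le_trans uve; apply: ub_le_sup => //; exists al; rewrite //= in_itv.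
apply: ge_sup => // _ [al /= + <-]; rewrite in_itv /= => al01.
by rewrite ge_max; apply/andP; exact: uve.
Qed.

Lemma fdistC u v : fdist u v = fdist v u.
Proof.
suff le_uv u' v' : fdist u' v' <= fdist v' u'.
  by apply/eqP; rewrite eq_le !le_uv.
apply/fdist_leP => al al01; rewrite distrC [X in _ /\ X <= _]distrC.
exact: (fdist_leP v' u' _).1 (lexx _) al al01.
Qed.

Lemma fdist_triangle u v w : fdist u w <= fdist u v + fdist v w.
Proof.
apply/fdist_leP => al al01.
have [luv ruv] := (fdist_leP u v _).1 (lexx _) al al01.
have [lvw rvw] := (fdist_leP v w _).1 (lexx _) al al01.
by split; [apply: le_trans (ler_distD (level_lo v al) _ _) _
  | apply: le_trans (ler_distD (level_hi v al) _ _) _]; rewrite lerD.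
Qed.

(** Each condition in [endpoint] concludes a non-strict inequality. Passing from [l] to a nearby
    [l'] and back costs [e / 2] twice, and [e] is arbitrary. *)
Lemma endpoint_uniform_lim l :
  (forall e, 0 < e -> exists2 l', endpoint l' &
     forall al, 0 <= al <= 1 -> `|l' al - l al| <= e) ->
  endpoint l.
Proof.
move=> lim_l; split.
- move=> al be al0 ab b1; apply/ler_addgt0Pr => e e0.
  have e20 : 0 < e / 2 by rewrite divr_gt0.
  have [l' [mono _ _] l'l] := lim_l _ e20.
  have al01 : 0 <= al <= 1 by rewrite al0 (le_trans ab).
  have be01 : 0 <= be <= 1 by rewrite (le_trans al0).
  have := mono _ _ al0 ab b1; have := l'l _ al01; have := l'l _ be01.
  by rewrite !ler_norml => /andP[? ?] /andP[? ?] ?; lra.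
- move=> al m al01 hm; apply/ler_addgt0Pr => e e0.
  have e20 : 0 < e / 2 by rewrite divr_gt0.
  have [l' [_ lc _] l'l] := lim_l _ e20.
  have /andP[al0 al1] := al01.
  have : l' al <= m + e / 2.
    apply: lc => // be /andP[b0 ba].
    have /l'l : 0 <= be <= 1 by rewrite ltW //= ltW // (lt_le_trans ba).
    have : l be <= m by apply: hm; rewrite b0.
    by rewrite ler_norml => ? /andP[? ?]; lra.
  have /l'l : 0 <= al <= 1 by rewrite ltW.
  by rewrite ler_norml => /andP[? ?] ?; lra.
- move=> m hm; apply/ler_addgt0Pr => e e0.
  have e20 : 0 < e / 2 by rewrite divr_gt0.
  have [l' [_ _ rc] l'l] := lim_l _ e20.
  have : m - e / 2 <= l' 0.
    apply: rc => be /andP[b0 b1].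
    have /l'l : 0 <= be <= 1 by rewrite ltW.
    have : m <= l be by apply: hm; rewrite b0.
    by rewrite ler_norml => ? /andP[? ?]; lra.
  have /l'l : 0 <= (0 : R) <= 1 by rewrite lexx ler01.
  by rewrite ler_norml => /andP[? ?] ?; lra.
Qed.

Lemma fuzzy_with_endpoints (l r : R -> R) :
  endpoint l -> endpoint (fun al => - r al) -> l 1 <= r 1 ->
  exists u, forall al, 0 <= al <= 1 -> level_lo u al = l al /\ level_hi u al = r al.
Proof.
move=> el er lr1; have [u uE] := fuzzy_of_endpoints el er lr1.
exists u => al al01; rewrite /level_lo /level_hi uE //.
have /andP[al0 al1] := al01.
(* By monotonicity [l al <= l 1 <= r 1 <= r al]. The interval is thus nonempty, so its infimum and
   supremum are really its endpoints. *)
have lr : l al <= r al.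
  have [ml _ _] := el; have [mr _ _] := er.
  apply: le_trans (ml _ _ al0 al1 _) _ => //; apply: le_trans lr1 _.
  by rewrite -lerN2; apply: mr.
by rewrite inf_itvcc ?sup_itvcc.
Qed.

(** The limit is taken pointwise by completeness of the reals. Any set [X] with its bound [e]
    carries over unchanged, so one [X] can later serve lower and upper endpoints at once. *)
Lemma uniform_cauchy_lim {S : Type} (F : set_system S) {FF : ProperFilter F}
    (I : set R) (g : S -> R -> R) :
  (forall e, 0 < e -> exists2 X, F X &
     forall x y : S, X x -> X y -> forall al, I al -> `|g x al - g y al| <= e) ->
  exists l : R -> R, forall (X : set S) e, F X ->
    (forall x y : S, X x -> X y -> forall al, I al -> `|g x al - g y al| <= e) ->
    forall x : S, X x -> forall al, I al -> `|g x al - l al| <= e.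
Proof.
move=> cF; exists (fun al => lim (g^~ al @ F)) => X e FX Xe x Xx al Ial.
have cvg_g : g^~ al @ F --> lim (g^~ al @ F).
  apply/cauchy_cvgP/cauchy_exP => d d0.
  have d20 : 0 < d / 2 by rewrite divr_gt0.
  have [Y FY Yd] := cF _ d20; have [y Yy] := filter_ex FY.
  exists (g y al); apply: (@filterS _ F _ Y) FY => z Yz /=.
  by rewrite -ball_normE /=; have := Yd _ _ Yy Yz al Ial; lra.
(* With [x] fixed, only [y] runs along [F]; the bound survives because a closed half-line contains
   its limits. *)
have cvg_d : (fun y => `|g x al - g y al|) @ F --> `|g x al - lim (g^~ al @ F)|.
  by apply: cvg_norm; apply: cvgB cvg_g; exact: cvg_cst.
apply: (closed_cvg _ (@closed_le R e)) cvg_d.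
by apply: (@filterS _ F _ X) FX => y Xy; exact: Xe.
Qed.

Lemma fuzzy_complete (F : set_system (fuzzy R)) {FF : ProperFilter F} :
  (forall e, 0 < e -> exists2 X, F X &
     forall u v, X u -> X v -> fdist u v < e) ->
  exists A, forall e, 0 < e -> F [set u | fdist u A < e].
Proof.
move=> cF; pose I : set R := [set al | 0 <= al <= 1].
have bounds X e : (forall u v, X u -> X v -> fdist u v < e) ->
    (forall u v, X u -> X v -> forall al, I al ->
       `|level_lo u al - level_lo v al| <= e) /\
    (forall u v, X u -> X v -> forall al, I al ->
       `|level_hi u al - level_hi v al| <= e).
  by move=> Xe; split=> u v Xu Xv al al01;
    have /ltW/fdist_leP/(_ al al01)[] := Xe _ _ Xu Xv.
have [|l lE] := @uniform_cauchy_lim _ F FF I (@level_lo R).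
  by move=> e /cF[X FX /bounds[? ?]]; exists X.
have [|r rE] := @uniform_cauchy_lim _ F FF I (@level_hi R).
  by move=> e /cF[X FX /bounds[? ?]]; exists X.
have near_lr e : 0 < e -> exists X, [/\ F X,
    forall u, X u -> forall al, I al -> `|level_lo u al - l al| <= e &
    forall u, X u -> forall al, I al -> `|level_hi u al - r al| <= e].
  by move=> /cF[X FX /bounds[Xlo Xhi]]; exists X; split=> //;
    [exact: lE | exact: rE].
have el : endpoint l.
  apply: endpoint_uniform_lim => e /near_lr[X [FX Xl _]].
  have [u Xu] := filter_ex FX; exists (level_lo u); first exact: endpoint_lo.
  exact: Xl.
have er : endpoint (fun al => - r al).
  apply: endpoint_uniform_lim => e /near_lr[X [FX _ Xr]].
  have [u Xu] := filter_ex FX.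
  exists (fun al => - level_hi u al); first exact: endpoint_hi.
  by move=> al al01; rewrite -opprD normrN; exact: Xr.
have lr1 : l 1 <= r 1.
  apply/ler_addgt0Pr => e e0; have e20 : 0 < e / 2 by rewrite divr_gt0.
  have [X [FX Xl Xr]] := near_lr _ e20; have [u Xu] := filter_ex FX.
  have I1 : I 1 by rewrite /I /= ler01 lexx.
  have := level_lo_le_hi u I1; have := Xl _ Xu _ I1; have := Xr _ Xu _ I1.
  by rewrite !ler_norml => /andP[? ?] /andP[? ?] ?; lra.
have [A AE] := fuzzy_with_endpoints el er lr1.
exists A => e e0; have e20 : 0 < e / 2 by rewrite divr_gt0.
have [X [FX Xl Xr]] := near_lr _ e20.
apply: filterS FX => u Xu /=.
(* Levelwise bounds control [fdist] only non-strictly; halving [e] restores strictness. *)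
apply: (@le_lt_trans _ _ (e / 2)); last by lra.
by apply/fdist_leP => al al01; have [-> ->] := AE al al01; split;
  [exact: Xl | exact: Xr].
Qed.

End FuzzyMetric.

Section Gauges.
Context {R : realType}.
Implicit Types (T : set R) (delta : (R -> R) * (R -> R)) (D : division R).
Local Open Scope classical_set_scope.

Definition gauge_min delta1 delta2 : (R -> R) * (R -> R) :=
  (delta1.1 \min delta2.1, delta1.2 \min delta2.2).

(** Every clause of [is_gauge], including the one with [mu], is a lower bound on a value, and lower
    bounds pass to minima. *)
Lemma is_gauge_min T a b delta1 delta2 :
  is_gauge T a b delta1 -> is_gauge T a b delta2 ->
  is_gauge T a b (gauge_min delta1 delta2).
Proof.
move=> [L1 R1 a1 b1 m1] [L2 R2 a2 b2 m2].
split=> [x Tx|x Tx|||x Tx] /=; rewrite ?lt_min ?le_min.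
- by rewrite L1 ?L2.
- by rewrite R1 ?R2.
- by rewrite a1.
- by rewrite b1.
- by rewrite m1 ?m2.
Qed.

Lemma is_fine_le T a b delta1 delta2 D :
  (forall x, delta1.1 x <= delta2.1 x) -> (forall x, delta1.2 x <= delta2.2 x) ->
  is_fine T a b delta1 D -> is_fine T a b delta2 D.
Proof.
move=> leL leR [x0 xn Tx fine]; split=> // i /fine[xi_in xiL lt_x xiR].
split=> //; first by apply: le_trans xiL; rewrite lerB.
by apply: le_trans xiR _; rewrite lerD.
Qed.

Lemma is_fine_min T a b delta1 delta2 D :
  is_fine T a b (gauge_min delta1 delta2) D ->
  is_fine T a b delta1 D /\ is_fine T a b delta2 D.
Proof.
by split; apply: is_fine_le H => x /=; rewrite ge_min lexx ?orbT.
Qed.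

(** Convergence of this family to [A] in [fdist] is exactly [is_fhk_integral T a b f A]. *)
Definition fine_sums T a b (f : R -> fuzzy R) : set_system (fuzzy R) :=
  filter_from [set delta | is_gauge T a b delta]
    (fun delta => [set riemann_sum f D | D in is_fine T a b delta]).

(** The first hypothesis makes the base nonempty; the second, the content of Cousin's lemma, makes
    each of its members nonempty. *)
Lemma fine_sums_filter T a b f :
  (exists delta, is_gauge T a b delta) ->
  (forall delta, is_gauge T a b delta -> exists D, is_fine T a b delta D) ->
  ProperFilter (fine_sums T a b f).
Proof.
move=> ex_gauge ex_fine; apply: filter_from_proper; last first.
  by move=> delta /ex_fine[D Dfine]; exists (riemann_sum f D), D.
apply: filter_from_filter => // delta1 delta2 g1 g2.
exists (gauge_min delta1 delta2); first exact: is_gauge_min.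
by move=> _ [D /is_fine_min[fine1 fine2] <-]; split; exists D.
Qed.

End Gauges.

Theorem theorem3 (R : realType) (T : set R) (hT : time_scale T) (a b : R)
    (ha : T a) (hb : T b) (hab : a < b) (f : R -> fuzzy R) :
  fhk_integrable T a b f <->
  (forall e : R, 0 < e -> exists delta : (R -> R) * (R -> R),
     is_gauge T a b delta /\
     forall D1 D2 : division R,
       is_fine T a b delta D1 -> is_fine T a b delta D2 ->
       fdist (riemann_sum f D1) (riemann_sum f D2) < e).
Proof.
split=> [[A intA] e e0|cauchy_f].
  have e20 : 0 < e / 2 by rewrite divr_gt0.
  have [delta [gauge_delta near_A]] := intA _ e20.
  exists delta; split=> // D1 D2 /near_A D1A /near_A D2A.
  apply: le_lt_trans (fdist_triangle _ A _) _.
  by rewrite [fdist A _]fdistC; lra.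
(* A gauge without fine divisions would vacuously make every fuzzy number an
   integral, so Cousin's lemma can be assumed instead of proved. *)
have [ex_fine|] := pselect (forall delta,
    is_gauge T a b delta -> exists D, is_fine T a b delta D); last first.
  move=> /existsNP[delta /not_implyP[gauge_delta no_fine]].
  exists (zerof R) => e _; exists delta; split=> // D fineD.
  by case: no_fine; exists D.
(* Any positive tolerance in the Cauchy condition supplies a gauge; 1 is an arbitrary choice. *)
have ex_gauge : exists delta, is_gauge T a b delta.
  by have [delta [? _]] := cauchy_f 1 ltr01; exists delta.
have FF := fine_sums_filter f ex_gauge ex_fine.
have [|A limA] := fuzzy_complete (F := fine_sums T a b f).
  move=> e /cauchy_f[delta [gauge_delta near_f]].
  exists [set riemann_sum f D | D in is_fine T a b delta]%classic.
    by exists delta.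
  by move=> _ _ [D1 fine1 <-] [D2 fine2 <-]; exact: near_f.
exists A => e /limA[delta gauge_delta near_A].
by exists delta; split=> // D fineD; apply: near_A; exists D.
Qed.
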